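(* Let $\mathcal C,\mathcal D,\mathcal Y$ be finite-dimensional Hilbert spaces and let $G:\mathcal C\to\mathcal D$, $O:\mathcal D\to\mathcal Y$ be linear maps with $OG=0$. Set $H:=(\operatorname{Im}G)^\perp\subset\mathcal D$ and $$\mu:=\inf_{\operatorname{dist}(d,\operatorname{Im}G)=1}\|Od\|_{\mathcal Y}.$$ Then $$\mu=\inf_{h\in H,\ \|h\|_{\mathcal D}=1}\|Oh\|_{\mathcal Y}=\sigma_{\min}(O|_H).$$ Consequently, $$\mu>0\iff\ker O\cap H=\{0\}\iff\ker O=\operatorname{Im}G.$$ Equivalently, the induced quotient map $\widetilde O:\mathcal D/\operatorname{Im}G\to\mathcal Y$, $\widetilde O([d])=Od$, is injective if and only if it is quantitatively coercive on the finite-dimensional quotient, i.e. there is $c>0$ with $\|Od\|_{\mathcal Y}\ge c\operatorname{dist}(d,\operatorname{Im}G)$ for all $d\in\mathcal D$.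
   Context: $\operatorname{dist}$ is the distance in the Hilbert norm of $\mathcal D$. $\sigma_{\min}(O|_H)$ is the smallest singular value of $O|_H:H\to\mathcal Y$, i.e. the square root of the smallest eigenvalue of $(O|_H)^*(O|_H)$ on $H$. The infimum over an empty unit sphere (case $H=\{0\}$) is $+\infty$ by convention, and so is $\sigma_{\min}$ in that case. *)

(* Defs.v *)
From HB Require Import structures.
From mathcomp Require Import all_boot all_order all_algebra.
From mathcomp Require Import boolp classical_sets reals constructive_ereal ereal.
From mathcomp Require Import complex.

Set Implicit Arguments.
Unset Strict Implicit.
Unset Printing Implicit Defensive.

Import Order.TTheory GRing.Theory Num.Theory.
Local Open Scope classical_set_scope.
Local Open Scope ring_scope.
Local Open Scope complex_scope.
Local Open Scope quotient_scope.

Variant scalar_kind := RealScalars | ComplexScalars.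

Definition scalar (R : realType) (k : scalar_kind) : numFieldType :=
  match k with RealScalars => R | ComplexScalars => R[i] end.

Definition conjs (R : realType) (k : scalar_kind) :
    {rmorphism scalar R k -> scalar R k} :=
  match k with RealScalars => idfun | ComplexScalars => Num.conj end.

Definition re (R : realType) (k : scalar_kind) : scalar R k -> R :=
  match k with RealScalars => id | ComplexScalars => @complex.Re R end.

(* A [vectType] is finite-dimensional, so completeness needs no axiom. The    *)
(* inner product is linear in its first argument and conjugate-linear in the  *)
(* second one.                                                                *)
HB.mixin Record isFinHilbert (R : realType) (k : scalar_kind) V
    of Vector (scalar R k) V := {
  inner : {dot V for conjs R k}
}.

#[short(type="finHilbertType")]
HB.structure Definition FinHilbert (R : realType) (k : scalar_kind) :=
  { V of Vector (scalar R k) V & isFinHilbert R k V }.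

Section SubspaceInner.
Variables (R : realType) (k : scalar_kind) (V : finHilbertType R k).
Variable W : {vspace V}.

Definition sub_inner (u v : subvs_of W) : scalar R k :=
  inner (vsval u) (vsval v).

Fact sub_inner_bilinear : bilinear_for
  (GRing.Scale.Law.clone _ _ *%R _)
  (GRing.Scale.Law.clone _ _ (conjs R k \; *%R) _) sub_inner.
Proof.
split=> [v a x y|u a x y]; rewrite /sub_inner.
  rewrite [vsval (_ + _)](linearP (@vsval _ _ W)) /= linearDl.
  by rewrite linearZl_LR.
rewrite [vsval (_ + _)](linearP (@vsval _ _ W)) /= linearDr.
by rewrite linearZr_LR.
Qed.

HB.instance Definition _ := bilinear_isBilinear.Build (scalar R k)
  (subvs_of W) (subvs_of W) (scalar R k) _ _ sub_inner sub_inner_bilinear.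

Fact sub_inner_herm (u v : subvs_of W) :
  sub_inner u v = (-1) ^+ false * conjs R k (sub_inner v u).
Proof. exact: hermC. Qed.

HB.instance Definition _ := isHermitianSesquilinear.Build (scalar R k)
  (subvs_of W) false (conjs R k) sub_inner sub_inner_herm.

Fact sub_inner_gt0 (u : subvs_of W) : u != 0 -> 0 < sub_inner u u.
Proof. by move=> u0; apply: neq0_dnorm_gt0. Qed.

HB.instance Definition _ := isDotProduct.Build (scalar R k)
  (subvs_of W) sub_inner sub_inner_gt0.

HB.instance Definition _ :=
  isFinHilbert.Build R k (subvs_of W) (sub_inner : {dot _ for conjs R k}).
End SubspaceInner.

Section HilbertNotions.
Variables (R : realType) (k : scalar_kind).
Implicit Types U V : finHilbertType R k.

Definition hnorm V (u : V) : R := Num.sqrt (re (inner u u)).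

Definition dist V (u : V) (W : {vspace V}) : R :=
  inf [set hnorm (u - w) | w in [set w | w \in W]].

Definition restrict U V (f : 'Hom(U, V)) (W : {vspace U}) :
    'Hom(subvs_of W, V) :=
  linfun (f \o vsval).

Definition adjoint U V (f : 'Hom(U, V)) : 'Hom(V, U) :=
  xget 0 [set g : 'Hom(V, U) |
    forall u v, inner (f u) v = inner u (g v)].

Lemma conjsK : involutive (conjs R k).
Proof. by case: k => x //=; exact: conjCK. Qed.

Lemma adjointP U V (f : 'Hom(U, V)) (u : U) (v : V) :
  inner (f u) v = inner u (adjoint f v).
Proof.
pose n := \dim {:U}; pose b := vbasis {:U}.
pose M : 'M[scalar R k]_n := \matrix_(i, j) inner b`_j b`_i.
have Mfree : row_free M.
  rewrite -kermx_eq0; apply/rowV0P => x /sub_kermxP xM.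
  have bfree : free b by exact: basis_free (vbasisP _).
  pose w := \sum_i conjs R k (x 0 i) *: b`_i.
  have bw j : inner (b`_(j : 'I_n)) w = 0.
    rewrite linear_sumr; transitivity ((x *m M) 0 j); last by rewrite xM mxE.
    rewrite mxE; apply: eq_bigr => i _.
    by rewrite linearZr_LR /= conjsK mxE.
  have w0 : w = 0.
    apply/eqP/negPn/negP => /(@neq0_dnorm_gt0 _ _ _ (inner : {dot U for conjs R k})).
    suff -> : inner w w = 0 by rewrite ltxx.
    rewrite {1}/w linear_sumlz big1 // => i _.
    by rewrite linearZl_LR /= bw mulr0.
  apply/rowP => i; rewrite mxE.
  have /freeP/(_ _ w0 i) h := bfree.
  by apply: (inv_inj conjsK); rewrite h rmorph0.
pose a (v : V) : 'rV[scalar R k]_n := \row_j inner (f b`_j) v.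
pose g (v : V) : U := \sum_i conjs R k ((a v *m invmx M) 0 i) *: b`_i.
have aP c v1 v2 : a (c *: v1 + v2) = conjs R k c *: a v1 + a v2.
  by apply/rowP => j; rewrite !mxE linearDr linearZr_LR.
have gP : linear g.
  move=> c v1 v2; rewrite /g aP mulmxDl -scalemxAl scaler_sumr -big_split /=.
  apply: eq_bigr => i _.
  by rewrite !mxE rmorphD rmorphM conjsK scalerDl scalerA.
pose gL : {linear V -> U} := HB.pack g (GRing.isLinear.Build _ _ _ _ g gP).
have main u' v' : inner (f u') v' = inner u' (g v').
  have bg j : inner (b`_(j : 'I_n)) (g v') = inner (f b`_j) v'.
    rewrite linear_sumr; transitivity ((a v' *m invmx M *m M) 0 j).
      rewrite [RHS]mxE; apply: eq_bigr => i _.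
      by rewrite linearZr_LR /= conjsK [M _ _]mxE.
    by rewrite mulmxKV -?row_free_unit // mxE.
  rewrite (coord_vbasis (memvf u')) linear_sum !linear_sumlz.
  apply: eq_bigr => i _; rewrite linearZ !linearZl_LR /=.
  by rewrite bg.
rewrite /adjoint; case: xgetP => [h _ hP|/(_ (linfun gL)) []]; first exact: hP.
by move=> u' v'; rewrite main lfunE.
Qed.

(* The order of [scalar R ComplexScalars] is partial: [m <= a] says that      *)
(* [a - m] is a nonnegative real.                                             *)
Definition smallest_eigenvalue V (f : 'End(V)) : scalar R k :=
  xget 0 [set m | passmx.leigenvalue f m /\
                  forall a, passmx.leigenvalue f a -> m <= a].

Definition sigma_min U V (f : 'Hom(U, V)) : \bar R :=
  if \dim {:U} == 0%N then +oo%E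
  else (Num.sqrt (re (smallest_eigenvalue (adjoint f \o f)%VF)))%:E.

(* Only meaningful when [f] vanishes on [W]; see [quot_mapE].                 *)
Definition quot_map U V (f : 'Hom(U, V)) (W : {vspace U}) :
    Quotient.quot W -> V :=
  fun x => f (repr x).

Lemma quot_mapE U V (f : 'Hom(U, V)) (W : {vspace U}) (u : U) :
  (W <= lker f)%VS -> quot_map f (\pi_(Quotient.quot W) u) = f u.
Proof.
move=> /subvP fW; apply/eqP; rewrite /quot_map -subr_eq0 -linearB -memv_ker.
by apply: fW; rewrite Quotient.idealrBE reprK.
Qed.

End HilbertNotions.

Arguments quot_map {R k U V} f W x.

(* Main.v *)
(* With [m] the infimum of the Rayleigh quotient [|f u|^2 / |u|^2], the        *)
(* operator [S = f^* f - m] is positive semidefinite.  If [S] were injective,  *)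
(* boundedness of [S^-1] and the Cauchy-Schwarz inequality for [<S u, v>],     *)
(*   [|u|^4 = <S (S^-1 u), u>^2 <= <S^-1 u, u> <S u, u>],                      *)
(* would make [S] coercive, contradicting the choice of [m].  Hence [m] is the *)
(* smallest eigenvalue, and the infimum is attained at an eigenvector.  This   *)
(* needs neither a spectral theorem nor compactness, and treats real and       *)
(* complex scalars alike because only real parts of inner products occur.      *)
(* The rest follows from [d = w + h] with [w] in [Im G] and [h] in [H], for    *)
(* which [dist d (Im G) = |h|] and [O d = O h]; the orthogonal projection onto *)
(* a subspace is [i i^*], where [i] is its inclusion.                          *)
From HB Require Import structures.
From mathcomp Require Import complex.
Require Import Defs.
From mathcomp Require Import all_boot all_order all_algebra.
From mathcomp Require Import boolp classical_sets reals constructive_ereal ereal.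
From mathcomp Require Import ring lra.

Set Implicit Arguments.
Unset Strict Implicit.
Unset Printing Implicit Defensive.

Import Order.TTheory GRing.Theory Num.Theory.
Local Open Scope classical_set_scope.
Local Open Scope ring_scope.

(** Everything is read off one minimiser. For nonzero H, [sphere_minP] gives a unit vector u of H
    with |O u| |v| <= |O v| for all v in H, where |O u| is the smallest singular value of the
    restriction. By [orthov_decomp] and [distE], only the component of d in H matters for both |O d|
    and the distance, so mu = |O u|. Then mu > 0 says that O kills no nonzero vector of H, and |O u|
    itself is the coercivity constant. The minimiser comes from [min_eigenvalueP], which rests on
    [coercive_psd]; the bound on the inverse used there is [bounded_lfunP], obtained by splitting a
    map into rank-one pieces. *)

Section Scalars.
Variables (R : realType) (k : scalar_kind).
Implicit Types (a b : R) (z : Defs.scalar R k).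

Definition of_real : R -> Defs.scalar R k :=
  match k with RealScalars => id | ComplexScalars => real_complex R end.

Lemma re_of_real a : re (of_real a) = a.
Proof. by rewrite /re /of_real; case: k. Qed.

Lemma reD z1 z2 : re (z1 + z2) = re z1 + re z2.
Proof. by rewrite /re; case: k z1 z2 => // -[x1 y1] [x2 y2]. Qed.

Lemma re0 : re (0 : Defs.scalar R k) = 0.
Proof. by rewrite /re; case: k. Qed.

Lemma re_of_realM a z : re (of_real a * z) = a * re z.
Proof.
rewrite /re /of_real; case: k z => // -[x y] /=.
by rewrite mul0r subr0.
Qed.

Lemma re_conjs z : re (conjs R k z) = re z.
Proof. by rewrite /re /conjs; case: k z => // -[x y]. Qed.

Lemma ler_of_real a b : (of_real a <= of_real b) = (a <= b).
Proof. by rewrite /of_real; case: k => //=; exact: lecR. Qed.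

(** In the partial order on complex numbers, 0 <= z forces the imaginary part to vanish. *)
Lemma ge0_of_realK z : 0 <= z -> of_real (re z) = z.
Proof.
rewrite /of_real /re; case: k z => // -[x y].
by rewrite lecE /= => /andP[/eqP -> _].
Qed.

Lemma of_realM a b : of_real (a * b) = of_real a * of_real b.
Proof. by rewrite /of_real; case: k => //=; exact: rmorphM. Qed.

Lemma of_real0 : of_real 0 = 0.
Proof. by rewrite /of_real; case: k. Qed.

Lemma of_realN1 : of_real (-1) = -1.
Proof. by rewrite /of_real; case: k => //=; exact: rmorphN1. Qed.

End Scalars.

Lemma discr_le0 (F : realFieldType) (a b c : F) : 0 <= c ->
  (forall t, 0 <= a + 2 * t * b + t ^+ 2 * c) -> b ^+ 2 <= a * c.
Proof.
rewrite le_eqVlt => /predU1P[<- h|c0 h].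
  have [->|b0] := eqVneq b 0; first by rewrite expr0n mulr0.
  (* With c = 0 the expression is affine in t; this t gives it the value -1. *)
  have := h (- (a + 1) / (2 * b)); rewrite mulr0 addr0.
  have -> : a + 2 * (- (a + 1) / (2 * b)) * b = -1 by field.
  by rewrite oppr_ge0 ler10.
(* The minimum of the quadratic is at t = -b/c. *)
have := h (- b / c).
have -> : a + 2 * (- b / c) * b + (- b / c) ^+ 2 * c = (a * c - b ^+ 2) / c.
  by field; rewrite gt_eqF.
by rewrite pmulr_lge0 ?invr_gt0 // subr_ge0.
Qed.

(** * Real parts of inner products *)

Section Forms.
Variables (R : realType) (k : scalar_kind).
Implicit Types U V : finHilbertType R k.

Definition rinner V (u v : V) : R := re (inner u v).

Lemma rinnerC V (u v : V) : rinner u v = rinner v u.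
Proof. by rewrite /rinner hermC expr0 mul1r re_conjs. Qed.

Lemma rinnerDl V (u v w : V) : rinner (u + v) w = rinner u w + rinner v w.
Proof. by rewrite /rinner linearDl reD. Qed.

Lemma rinnerDr V (u v w : V) : rinner w (u + v) = rinner w u + rinner w v.
Proof. by rewrite rinnerC rinnerDl !(rinnerC _ w). Qed.

Lemma rinnerZl V a (u v : V) : rinner (of_real k a *: u) v = a * rinner u v.
Proof. by rewrite /rinner linearZl_LR re_of_realM. Qed.

Lemma rinnerZr V a (u v : V) : rinner u (of_real k a *: v) = a * rinner u v.
Proof. by rewrite rinnerC rinnerZl rinnerC. Qed.

Lemma inner_ge0 V (u : V) : 0 <= inner u u.
Proof.
have [->|u0] := eqVneq u 0; first by rewrite linear0l.
by rewrite ltW // neq0_dnorm_gt0.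
Qed.

Lemma rinnerE V (u : V) : inner u u = of_real k (rinner u u).
Proof. by rewrite /rinner ge0_of_realK // inner_ge0. Qed.

Lemma rinner_ge0 V (u : V) : 0 <= rinner u u.
Proof. by rewrite -(ler_of_real k) -rinnerE of_real0 inner_ge0. Qed.

Lemma rinner_eq0 V (u : V) : (rinner u u == 0) = (u == 0).
Proof.
apply/eqP/eqP => [uu|->]; last by rewrite /rinner linear0l re0.
apply/eqP; apply: contraT.
move=> /(@neq0_dnorm_gt0 _ _ _ (inner : {dot V for conjs R k})).
by rewrite rinnerE uu of_real0 ltxx.
Qed.

Lemma rinner_gt0 V (u : V) : (0 < rinner u u) = (u != 0).
Proof. by rewrite lt_neqAle rinner_ge0 eq_sym rinner_eq0 andbT. Qed.

Lemma rinnerCS V (u v : V) : rinner u v ^+ 2 <= rinner u u * rinner v v.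
Proof.
apply: discr_le0 (rinner_ge0 v) _ => t.
have := rinner_ge0 (u + of_real k t *: v).
rewrite !(rinnerDl, rinnerDr, rinnerZl, rinnerZr) (rinnerC v u).
by congr (0 <= _); ring.
Qed.

(** * Boundedness of linear maps *)

Definition bounded_lfun U V (f : 'Hom(U, V)) :=
  exists2 K : R, 0 < K & forall u, rinner (f u) (f u) <= K * rinner u u.

Lemma bounded_add U V (f g : 'Hom(U, V)) :
  bounded_lfun f -> bounded_lfun g -> bounded_lfun (f + g).
Proof.
move=> [K K0 fK] [L L0 gL]; exists (2 * (K + L)) => [|u].
  by rewrite mulr_gt0 ?addr_gt0.
rewrite add_lfunE; have := fK u; have := gL u.
(* Expanding |f u - g u|^2 >= 0 gives |f u + g u|^2 <= 2 |f u|^2 + 2 |g u|^2. *)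
have := rinner_ge0 (f u - g u).
rewrite -scaleN1r -of_realN1 !(rinnerDl, rinnerDr, rinnerZl, rinnerZr).
by rewrite (rinnerC (g u)); lra.
Qed.

Lemma bounded_0 U V : bounded_lfun (0 : 'Hom(U, V)).
Proof.
exists 1 => // u; rewrite zero_lfunE /rinner linear0l re0 mul1r.
exact: rinner_ge0.
Qed.

(** Both sides are |a|^2 |u|^2 |v|^2; this form avoids a modulus common to both kinds of scalars. *)
Lemma rinner_scaleC U V (a : Defs.scalar R k) (u : U) (v : V) :
  rinner (a *: u) (a *: u) * rinner v v = rinner (a *: v) (a *: v) * rinner u u.
Proof.
rewrite /rinner !linearZl_LR !linearZr_LR /= !mulrA (rinnerE u) (rinnerE v).
by rewrite ![a * _ * _]mulrC !re_of_realM !re_of_real; ring.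
Qed.

(* The adjoint of [u |-> phi u *: w] represents [phi] up to a factor, as in   *)
(* Riesz's theorem.                                                           *)
Lemma bounded_rank1 U V (phi : {scalar U}) (w : V) (f : 'Hom(U, V)) :
  (forall u, f u = phi u *: w) -> bounded_lfun f.
Proof.
move=> fE; have [w0|w0] := eqVneq w 0.
  have -> : f = 0 by apply/lfunP => u; rewrite fE w0 scaler0 zero_lfunE.
  exact: bounded_0.
set z := adjoint f w.
have ww : 0 < rinner w w by rewrite rinner_gt0.
(* The summand 1 only makes the constant positive when z = 0. *)
exists (rinner z z / rinner w w + 1) => [|u].
  by rewrite ltr_wpDl // divr_ge0 ?rinner_ge0.
have [->|fu0] := eqVneq (f u) 0.
  rewrite {1}/rinner linear0l re0 mulr_ge0 ?rinner_ge0 //.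
  by rewrite addr_ge0 // divr_ge0 ?rinner_ge0.
have fu : 0 < rinner (f u) (f u) by rewrite rinner_gt0.
(* Since f^* f u = phi u *: z, Cauchy-Schwarz times |w|^2 reads |f u|^4 |w|^2 <= |u|^2 |f u|^2
   |z|^2, and |f u|^2 cancels. *)
have /(ler_wpM2r (rinner_ge0 w)) := rinnerCS u (adjoint f (f u)).
rewrite -[rinner u (adjoint _ _)]/(re _) -adjointP -/(rinner _ _).
have -> : adjoint f (f u) = phi u *: z by rewrite fE linearZ.
rewrite -[X in _ <= X]mulrA rinner_scaleC -fE => h.
suff : rinner (f u) (f u) * rinner w w <= rinner u u * rinner z z.
  rewrite -ler_pdivlMr // => /le_trans -> //.
  by have := rinner_ge0 u; lra.
rewrite -(ler_pM2l fu); apply: le_trans (le_trans _ h) _.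
  by rewrite expr2 mulrA.
by rewrite le_eqVlt; apply/orP; left; apply/eqP; ring.
Qed.

(** Expanding u in a basis makes f a finite sum of maps of the form treated in [bounded_rank1]. *)
Lemma bounded_lfunP U V (f : 'Hom(U, V)) : bounded_lfun f.
Proof.
pose b := vbasis {:U}.
have gP i : linear (fun u => coord b i u *: f b`_i).
  by move=> a u v; rewrite linearP scalerDl scalerA.
pose gL i : {linear U -> V} := HB.pack (fun u => coord b i u *: f b`_i)
  (GRing.isLinear.Build _ _ _ _ _ (gP i)).
pose g i := linfun (gL i).
have fE : f = \sum_i g i.
  apply/lfunP => u; rewrite {1}(coord_vbasis (memvf u)) linear_sum sum_lfunE.
  by apply: eq_bigr => i _; rewrite lfunE /= linearZ.
rewrite fE; apply: (big_ind (@bounded_lfun U V)) => [|g1 g2|i _].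
- exact: bounded_0.
- exact: bounded_add.
- by apply: (@bounded_rank1 U V (coord b i) (f b`_i)) => u; rewrite lfunE.
Qed.

(** * Coercivity and the smallest eigenvalue *)

Lemma coercive_psd V (S : 'End(V)) :
  (forall u v, rinner (S u) v = rinner u (S v)) ->
  (forall u, 0 <= rinner u (S u)) -> lker S = 0%VS ->
  exists2 c : R, 0 < c & forall u, c * rinner u u <= rinner u (S u).
Proof.
move=> sym psd /eqP ker0; have [K K0 SK] := bounded_lfunP (S^-1%VF).
have SVK u : S (S^-1%VF u) = u by rewrite lker0_lfunVK.
have CS u v : rinner u (S v) ^+ 2 <= rinner u (S u) * rinner v (S v).
  apply: discr_le0 (psd v) _ => t.
  have := psd (u + of_real k t *: v).
  rewrite linearD linearZ !(rinnerDl, rinnerDr, rinnerZl, rinnerZr).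
  by rewrite (rinnerC v (S u)) sym; congr (0 <= _); ring.
(* From |S^-1 u - u|^2 >= 0 one gets 2 <S^-1 u, u> <= |S^-1 u|^2 + |u|^2 <= (K + 1) |u|^2. *)
pose L := (K + 1) / 2.
have L0 : 0 < L by rewrite divr_gt0 // addr_gt0.
exists L^-1 => [|u]; first by rewrite invr_gt0.
have [->|u0] := eqVneq u 0; first by rewrite linear0 /rinner linear0l re0 mulr0.
have uu : 0 < rinner u u by rewrite rinner_gt0.
have Lu : rinner (S^-1%VF u) u <= L * rinner u u.
  have := SK u; have := rinner_ge0 (S^-1%VF u + of_real k (-1) *: u).
  rewrite !(rinnerDl, rinnerDr, rinnerZl, rinnerZr) /L (rinnerC u).
  by lra.
rewrite ler_pdivrMl // -(ler_pM2l uu) -expr2.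
have := CS u (S^-1%VF u); rewrite SVK => /le_trans -> //.
rewrite [leRHS]mulrA [_ * L]mulrC [leLHS]mulrC.
exact: ler_wpM2r.
Qed.

Lemma min_eigenvalueP U V (f : 'Hom(U, V)) : \dim {:U} != 0%N ->
  exists m : R, exists u : U,
    [/\ u != 0, (adjoint f \o f)%VF u = of_real k m *: u &
        forall v, m * rinner v v <= rinner (f v) (f v)].
Proof.
move=> dimU; pose T := (adjoint f \o f)%VF.
have rinnerT u v : rinner u (T v) = rinner (f u) (f v).
  by rewrite /rinner comp_lfunE -adjointP.
have [u1 u10] : exists u1 : U, u1 != 0.
  exists (vpick {:U}); rewrite vpick0; apply: contra dimU => /eqP ->.
  by rewrite dimv0.
pose E := [set rinner (f u) (f u) / rinner u u | u in [set u : U | u != 0]].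
have E0 : nonempty E by exists (rinner (f u1) (f u1) / rinner u1 u1), u1.
have lbE : has_lbound E.
  by exists 0 => _ [u _ <-]; rewrite divr_ge0 ?rinner_ge0.
pose m := inf E; pose S := T - of_real k m *: \1%VF.
have SE u v : rinner u (S v) = rinner (f u) (f v) - m * rinner u v.
  rewrite add_lfunE opp_lfunE scale_lfunE id_lfunE -scaleN1r -of_realN1.
  by rewrite rinnerDr !rinnerZr rinnerT mulN1r.
have mP v : m * rinner v v <= rinner (f v) (f v).
  have [->|v0] := eqVneq v 0.
    by rewrite linear0 /rinner !linear0l !re0 mulr0.
  by rewrite -ler_pdivlMr ?rinner_gt0 //; apply: ge_inf => //; exists v.
have [ker0|] := eqVneq (lker S) 0%VS; last first.
  rewrite -vpick0 => u0; exists m, (vpick (lker S)); split=> //.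
  have := memv_pick (lker S); rewrite memv_ker.
  by rewrite add_lfunE opp_lfunE scale_lfunE id_lfunE subr_eq0 => /eqP.
have [||//|c c0 Sc] := @coercive_psd U S.
- by move=> u v; rewrite rinnerC !SE (rinnerC v) (rinnerC (f v)).
- by move=> u; rewrite SE subr_ge0.
(* Coercivity of S would make m + c a lower bound of the Rayleigh quotients. *)
suff : m + c <= m by rewrite gerDl leNgt c0.
apply: lb_le_inf => // _ [u u0 <-].
rewrite ler_pdivlMr ?rinner_gt0 // mulrDl -lerBrDl -SE; exact: Sc.
Qed.

(** * Norms, orthogonal projection and the minimum on the unit sphere *)

Lemma hnormE V (u : V) : hnorm u = Num.sqrt (rinner u u).
Proof. by []. Qed.

Lemma hnorm_sqr V (u : V) : hnorm u ^+ 2 = rinner u u.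
Proof. by rewrite hnormE sqr_sqrtr // rinner_ge0. Qed.

Lemma hnorm_eq0 V (u : V) : (hnorm u == 0) = (u == 0).
Proof. by rewrite -sqrf_eq0 hnorm_sqr rinner_eq0. Qed.

Lemma hnorm0 V : hnorm (0 : V) = 0.
Proof. by apply/eqP; rewrite hnorm_eq0. Qed.

Lemma hnormZ V a (u : V) : 0 <= a -> hnorm (of_real k a *: u) = a * hnorm u.
Proof.
move=> a0; rewrite !hnormE rinnerZl rinnerZr mulrA -expr2.
by rewrite sqrtrM ?sqr_ge0 // sqrtr_sqr ger0_norm.
Qed.

(** An eigenvector v for the eigenvalue a satisfies a |v|^2 = |f v|^2 >= m |v|^2, so m <= a even in
    the partial order; antisymmetry then leaves m as the only value [xget] can return. *)
Lemma smallest_eigenvalueE U V (f : 'Hom(U, V)) m (u : U) :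
  u != 0 -> (adjoint f \o f)%VF u = of_real k m *: u ->
  (forall v, m * rinner v v <= rinner (f v) (f v)) ->
  smallest_eigenvalue (adjoint f \o f)%VF = of_real k m.
Proof.
move=> u0 fu mP; set T := (adjoint f \o f)%VF.
have eig a : passmx.leigenvalue T a <-> exists2 v : U, v != 0 & T v = a *: v.
  rewrite /passmx.leigenvalue /passmx.leigenspace; split=> [|[v v0 Tv]].
    rewrite -vpick0 => v0; exists (vpick (lker (T - a *: \1%VF))) => //.
    apply/eqP; rewrite -subr_eq0; have := memv_pick (lker (T - a *: \1%VF)).
    by rewrite memv_ker add_lfunE opp_lfunE scale_lfunE id_lfunE.
  apply: contra v0 => /eqP k0; rewrite -memv0 -k0 memv_ker.
  by rewrite add_lfunE opp_lfunE scale_lfunE id_lfunE Tv subrr.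
have eigm : passmx.leigenvalue T (of_real k m) by apply/eig; exists u.
have mle a : passmx.leigenvalue T a -> of_real k m <= a.
  move=> /eig[v v0 Tv]; have vv : 0 < inner v v by apply: neq0_dnorm_gt0.
  have vT : inner (f v) (f v) = a * inner v v.
    rewrite -linearZl_LR -Tv comp_lfunE [LHS]hermC [RHS]hermC.
    by congr (_ * conjs R k _); exact: adjointP.
  by rewrite -(ler_pM2r vv) -vT !rinnerE -of_realM ler_of_real.
rewrite /smallest_eigenvalue.
case: xgetP => [a -> [ea al]|/(_ (of_real k m)) []].
  by apply/eqP; rewrite eq_le al // mle.
by split.
Qed.

Lemma orthov_decomp V (W : {vspace V}) (d : V) :
  exists2 w : V, w \in W & d - w \in orthov inner W.
Proof.
pose i : 'Hom(subvs_of W, V) := linfun vsval.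
have iE w : i w = vsval w by rewrite lfunE.
(* Since W carries the inner product of V, <i x, d> = <x, i^* d> = <i x, i i^* d> for every x. *)
exists (vsval (adjoint i d)); first exact: subvsP.
apply/mem_orthovP => v vW.
have -> : v = i (Sub v vW) by rewrite iE.
apply/eqP; rewrite herm_eq0C linearBr /= adjointP -iE.
by rewrite !iE subrr.
Qed.

(** By Pythagoras |w + h - v|^2 = |h|^2 + |w - v|^2 for v in W, with minimum at v = w. *)
Lemma distE V (W : {vspace V}) (w h : V) :
  w \in W -> h \in orthov inner W -> dist (w + h) W = hnorm h.
Proof.
move=> wW hW; apply/eqP; rewrite eq_le; apply/andP; split.
  apply: ge_inf; last by exists w => //; rewrite addrAC subrr add0r.
  by exists 0 => _ [v _ <-]; exact: sqrtr_ge0.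
apply: lb_le_inf; first by exists (hnorm (w + h - w)), w.
move=> _ [v vW <-]; rewrite !hnormE ler_wsqrtr //.
have /mem_orthovP/(_ _ (memvB wW vW)) hv := hW.
rewrite addrAC !(rinnerDl _ h, rinnerDr _ h).
have hv0 : rinner h (w - v) = 0 by rewrite /rinner hv re0.
by rewrite (rinnerC _ h) hv0 addr0 add0r lerDr rinner_ge0.
Qed.

(** The vector is a normalised eigenvector for the smallest eigenvalue m of g^* g, with g the
    restriction of f to W, so |f u| = sqrt m. The last inequality is the homogeneous form of
    minimality, which also serves as coercivity. *)
Lemma sphere_minP U V (f : 'Hom(U, V)) (W : {vspace U}) : W != 0%VS ->
  exists u : U, [/\ u \in W, hnorm u = 1,
    sigma_min (restrict f W) = (hnorm (f u))%:E &
    forall v : U, v \in W -> hnorm (f u) * hnorm v <= hnorm (f v)].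
Proof.
move=> W0; have dimW : \dim {: subvs_of W} != 0%N.
  by rewrite dimvf /= dimv_eq0.
have [m [u [u0 eu mP]]] := min_eigenvalueP (restrict f W) dimW.
have restrE v : restrict f W v = f (vsval v) by rewrite lfunE.
have fuu : rinner (restrict f W u) (restrict f W u) = m * rinner u u.
  by rewrite -rinnerZr -eu comp_lfunE /rinner -adjointP.
have m0 : 0 <= m.
  have uu : 0 < rinner u u by rewrite rinner_gt0.
  by rewrite -(pmulr_lge0 _ uu) -fuu rinner_ge0.
pose r := (hnorm u)^-1.
have r0 : 0 <= r by rewrite invr_ge0 sqrtr_ge0.
exists (of_real k r *: vsval u).
have fuE : hnorm (f (of_real k r *: vsval u)) = Num.sqrt m.
  rewrite linearZ /= hnormZ // -restrE /r !hnormE fuu sqrtrM // mulrCA.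
  rewrite mulVf ?mulr1 //.
  by rewrite gt_eqF // sqrtr_gt0 rinner_gt0.
split.
- by rewrite memvZ // subvsP.
- by rewrite hnormZ // mulVf // hnorm_eq0.
- rewrite /sigma_min (negPf dimW) (smallest_eigenvalueE u0 eu mP) re_of_real.
  by rewrite fuE.
move=> v vW; rewrite fuE -sqrtrM // ler_wsqrtr //.
by have := mP (Sub v vW); rewrite restrE.
Qed.

End Forms.

Theorem theorem15p1 (R : realType) (k : scalar_kind)
    (C D Y : finHilbertType R k) (G : 'Hom(C, D)) (O : 'Hom(D, Y))
    (OG0 : (O \o G)%VF = 0) :
  let H : {vspace D} := orthov inner (limg G) in
  let mu : \bar R :=
    ereal_inf [set (hnorm (O d))%:E | d in [set d : D | dist d (limg G) = 1]] in
  let Otilde : Quotient.quot (limg G) -> Y := quot_map O (limg G) in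
  [/\ mu = ereal_inf
             [set (hnorm (O h))%:E | h in [set h : D | h \in H /\ hnorm h = 1]]
    & ereal_inf
        [set (hnorm (O h))%:E | h in [set h : D | h \in H /\ hnorm h = 1]]
      = sigma_min (restrict O H)] /\
  [/\ (0 < mu)%E <-> (lker O :&: H = 0)%VS
    & (lker O :&: H = 0)%VS <-> lker O = limg G] /\
  [/\ lker O = limg G <-> injective Otilde
    & injective Otilde <->
      exists2 c : R, 0 < c & forall d : D, hnorm (O d) >= c * dist d (limg G)].
Proof.
move=> H mu Otilde.
have kerG : (limg G <= lker O)%VS.
  apply/subvP => _ /memv_imgP[c _ ->]; rewrite memv_ker.
  by rewrite -comp_lfunE OG0 zero_lfunE.
have Odec (w h : D) : w \in limg G -> O (w + h) = O h.
  move=> /(subvP kerG); rewrite memv_ker => /eqP Ow.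
  by rewrite linearD /= Ow add0r.
have decomp d : exists w h : D, [/\ w \in limg G, h \in H & d = w + h].
  have [w wG hH] := orthov_decomp (limg G) d.
  by exists w, (d - w); split=> //; rewrite addrC subrK.
have dist_H (h : D) : h \in H -> dist h (limg G) = hnorm h.
  by move=> hH; rewrite -[h in LHS]add0r distE // mem0v.
have muE : mu = ereal_inf
    [set (hnorm (O h))%:E | h in [set h : D | h \in H /\ hnorm h = 1]].
  (* The two sets of values coincide: passing from d to its component in H preserves O d, and the
     distance becomes the norm. *)
  congr ereal_inf; apply/seteqP; split=> _ [d /= dP <-].
    have [w [h [wG hH dE]]] := decomp d; exists h; last by rewrite dE Odec.
    by split=> //; rewrite -(distE wG hH) -dE.
  by have [dH d1] := dP; exists d => //=; rewrite dist_H.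
have inf_sphere (u : D) : u \in H -> hnorm u = 1 ->
    (forall v : D, v \in H -> hnorm (O u) * hnorm v <= hnorm (O v)) ->
    mu = (hnorm (O u))%:E.
  move=> uH u1 uP; rewrite muE; apply/eqP; rewrite eq_le; apply/andP; split.
    by apply: ereal_inf_lbound; exists u.
  apply: le_ereal_inf_tmp => _ [v [vH v1] <-].
  by rewrite lee_fin (le_trans _ (uP v vH)) // v1 mulr1.
(* The unit sphere of the zero space is empty, and the infimum of the empty set is +oo. *)
have mu0 : H = 0%VS -> mu = +oo%E.
  move=> H0; rewrite muE -(ereal_inf0 R); congr ereal_inf.
  apply/seteqP; split=> // x [h [hH h1] _]; move: hH h1.
  rewrite H0 memv0 => /eqP -> /eqP.
  by rewrite hnorm0 eq_sym oner_eq0.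
have ker_capE : (lker O :&: H = 0)%VS <-> lker O = limg G.
  split=> [cap0|kerE].
    apply/eqP; rewrite eqEsubv kerG andbT; apply/subvP => d dO.
    have [w [h [wG hH dE]]] := decomp d.
    suff : h \in (lker O :&: H)%VS.
      by rewrite cap0 memv0 => /eqP h0; rewrite dE h0 addr0.
    by rewrite memv_cap hH andbT memv_ker -(Odec _ h wG) -dE -memv_ker.
  apply/eqP; rewrite -subv0; apply/subvP => d; rewrite memv_cap kerE.
  (* A vector in both Im G and H is orthogonal to itself. *)
  move=> /andP[dG /mem_orthovP/(_ _ dG) dd].
  by rewrite memv0 -rinner_eq0 /rinner dd re0.
have injE : lker O = limg G <-> injective Otilde.
  split=> [kerE x y|inj].
    rewrite /Otilde /quot_map => /eqP; rewrite -subr_eq0 -linearB -memv_ker.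
    by rewrite kerE Quotient.idealrBE !reprK => /eqP.
  apply/eqP; rewrite eqEsubv kerG andbT; apply/subvP => d.
  rewrite memv_ker => /eqP dO; rewrite -[d]subr0 Quotient.idealrBE; apply/eqP.
  (* The classes of d and 0 have the same image, so d lies in Im G. *)
  by apply: inj; rewrite /Otilde !quot_mapE // linear0.
have mu_gt0 : (0 < mu)%E <-> (lker O :&: H = 0)%VS.
  have [H0|/(sphere_minP O)[u [uH u1 _ uP]]] := eqVneq H 0%VS.
    by rewrite (mu0 H0) ltry H0 capv0.
  rewrite (inf_sphere u) // lte_fin; split=> [u0|cap0].
    apply/eqP; rewrite -subv0; apply/subvP => d.
    rewrite memv_cap memv_ker memv0 => /andP[/eqP dO dH].
    have := uP d dH; rewrite dO hnorm0.
    rewrite pmulr_rle0 // -hnorm_eq0 eq_le => ->; exact: sqrtr_ge0.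
  rewrite lt_neqAle sqrtr_ge0 andbT eq_sym hnorm_eq0.
  apply: contra_eq_neq u1 => uO; suff : u \in (lker O :&: H)%VS.
    rewrite cap0 memv0 -hnorm_eq0 => /eqP ->; by rewrite eq_sym oner_eq0.
  by rewrite memv_cap uH memv_ker uO eqxx.
split; [split=> //|split; [split=> //|split=> //]].
  rewrite -muE; have [H0|/(sphere_minP O)[u [uH u1 -> uP]]] := eqVneq H 0%VS.
    by rewrite (mu0 H0) /sigma_min dimvf /= dimv_eq0 H0 eqxx.
  exact: inf_sphere.
apply: iff_trans (iff_sym injE) _; split=> [kerE|[c c0 cP]].
  have := mu_gt0.2 (ker_capE.2 kerE).
  have [H0 _|/(sphere_minP O)[u [uH u1 _ uP]]] := eqVneq H 0%VS.
    (* Here Im G is all of D and every distance is 0, so any positive constant works. *)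
    exists 1 => // d; have [w [h [wG hH dE]]] := decomp d.
    rewrite dE distE // Odec //; move: hH; rewrite H0 memv0 => /eqP ->.
    by rewrite linear0 !hnorm0 mulr0.
  rewrite (inf_sphere u) // lte_fin => u0; exists (hnorm (O u)) => // d.
  have [w [h [wG hH dE]]] := decomp d.
  by rewrite dE distE // Odec // uP.
apply/eqP; rewrite eqEsubv kerG andbT; apply/subvP => d.
rewrite memv_ker => /eqP dO; have [w [h [wG hH dE]]] := decomp d.
(* For d in ker O, coercivity reads c |h| <= 0, which leaves d = w in Im G. *)
have := cP d; rewrite dO dE distE // hnorm0.
rewrite pmulr_rle0 // => h0.
have : hnorm h == 0 by rewrite eq_le h0 sqrtr_ge0.
by rewrite hnorm_eq0 => /eqP ->; rewrite addr0.
Qed.
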